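(* If the metric spaces $(X,d_X)$ and $(Y,d_Y)$ are roughly isometric, then $C(X,d_X)=C(Y,d_Y)$.
   Context: For a metric space $(X,d)$ and $\mu,\delta \geq 0$, say that $(X,d)$ satisfies the $(\mu,\delta)$-four-point inequality if for all $x,y,z,w\in X$, $d(x,y)+d(z,w)\le \mu\max\{d(x,z)+d(y,w),\ d(x,w)+d(y,z)\}+2\delta$. The quasi-hyperbolicity constant of $(X,d)$ is $C(X,d)=\inf\{\mu\geq 0\mid \text{there exists }\delta\geq 0\text{ such that }(X,d)\text{ satisfies the }(\mu,\delta)\text{-four-point inequality}\}$. A map $f\colon X\to Y$ is a rough isometry if there exists $k\geq 0$ such that $|d_Y(f(u),f(v))-d_X(u,v)|\leq k$ for all $u,v\in X$, and there exists $R>0$ such that for every $y\in Y$ there is $x\in X$ with $d_Y(f(x),y)<R$. Two metric spaces are roughly isometric if there exists a rough isometry between them. *)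

(* Defs.v *)
From mathcomp Require Import all_boot all_order all_algebra.
From mathcomp Require Import boolp classical_sets reals topology.
From mathcomp Require Import lra.

Set Implicit Arguments.
Unset Strict Implicit.
Unset Printing Implicit Defensive.

Import Order.TTheory GRing.Theory Num.Theory.

Local Open Scope classical_set_scope.
Local Open Scope ring_scope.

Definition four_point_inequality (R : realType) (X : metricType R)
    (mu delta : R) : Prop :=
  forall x y z w : X,
    mdist x y + mdist z w <=
      mu * Num.max (mdist x z + mdist y w) (mdist x w + mdist y z) + 2 * delta.

Definition quasi_hyperbolicity_set (R : realType) (X : metricType R) : set R :=
  [set mu | 0 <= mu /\
    exists delta : R, 0 <= delta /\ four_point_inequality X mu delta].

Definition quasi_hyperbolicity_constant (R : realType) (X : metricType R) : R :=
  inf (quasi_hyperbolicity_set X).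

(* [inf] is a junk value on sets that are empty or unbounded below; neither
   case occurs here, since (2, 0) works in every metric space. *)
Lemma has_inf_quasi_hyperbolicity_set (R : realType) (X : metricType R) :
  has_inf (quasi_hyperbolicity_set X).
Proof.
split; last by exists 0 => mu [].
exists 2; split=> //; exists 0; split=> // x y z w.
have h1 := metric_triangle x z y; have h2 := metric_triangle x w y.
have h3 := metric_triangle z x w; have h4 := metric_triangle z y w.
rewrite (metric_sym z y) in h1 h4; rewrite (metric_sym w y) in h2.
rewrite (metric_sym z x) in h3.
have : mdist x z + mdist y w <=
  Num.max (mdist x z + mdist y w) (mdist x w + mdist y z).
  by rewrite le_max lexx.
have : mdist x w + mdist y z <=
  Num.max (mdist x z + mdist y w) (mdist x w + mdist y z).
  by rewrite le_max lexx orbT.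
lra.
Qed.

Definition rough_isometry (R : realType) (X Y : metricType R)
    (f : X -> Y) : Prop :=
  (exists k : R, 0 <= k /\
     forall u v : X, `|mdist (f u) (f v) - mdist u v| <= k) /\
  (exists r : R, 0 < r /\ forall y : Y, exists x : X, mdist (f x) y < r).

Definition roughly_isometric (R : realType) (X Y : metricType R) : Prop :=
  exists f : X -> Y, rough_isometry f.

(* Main.v *)
Require Import Defs.
From mathcomp Require Import all_boot all_order all_algebra.
From mathcomp Require Import boolp classical_sets reals topology.
From mathcomp Require Import lra.

Import Order.TTheory GRing.Theory Num.Theory.

Local Open Scope classical_set_scope.
Local Open Scope ring_scope.

(** A map that distorts distances by at most an additive constant pulls a
    four-point inequality of its target back to its source: the error affects
    only the additive term [delta], never the multiplicative constant [mu]
    ([four_point_inequality_pullback]).  So the set of admissible [mu] of the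
    target is included in that of the source.  A rough isometry is such a map,
    and since its image is coarsely dense it has a quasi-inverse, which is such
    a map in the other direction ([rough_isometry_quasi_inverse]).  The two sets
    of admissible constants are therefore equal, and so are their infima. *)

Definition additive_distortion {R : realType} {A B : metricType R}
    (c : R) (g : A -> B) : Prop :=
  forall u v : A, `|mdist (g u) (g v) - mdist u v| <= c.

(** Each of the three sums of two distances changes by at most [2 * c]; the
    change on the left costs [c] in [delta], and the change inside the maximum
    is multiplied by [mu] and costs [mu * c]. *)
Lemma four_point_inequality_pullback {R : realType} {A B : metricType R}
    (g : A -> B) (c mu delta : R) :
  0 <= mu -> additive_distortion c g ->
  four_point_inequality B mu delta ->
  four_point_inequality A mu (delta + c + mu * c).
Proof.
move=> mu0 gc B4 x y z w.
have lo u v : mdist u v <= mdist (g u) (g v) + c.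
  by have := gc u v; rewrite ler_norml => /andP[]; lra.
have up u v : mdist (g u) (g v) <= mdist u v + c.
  by have := gc u v; rewrite ler_norml => /andP[]; lra.
have := B4 (g x) (g y) (g z) (g w).
set MB := Num.max _ _; set MA := Num.max _ _ => B4g.
have maxBA : MB <= MA + 2 * c.
  have le1 : mdist x z + mdist y w <= MA by rewrite le_max lexx.
  have le2 : mdist x w + mdist y z <= MA by rewrite le_max lexx orbT.
  rewrite ge_max; apply/andP; split.
    by have := up x z; have := up y w; lra.
  by have := up x w; have := up y z; lra.
have := ler_wpM2l mu0 maxBA; rewrite mulrDr => muBA.
by have := lo x y; have := lo z w; lra.
Qed.

Lemma quasi_hyperbolicity_set_pullback {R : realType} {A B : metricType R}
    (g : A -> B) (c : R) :
  0 <= c -> additive_distortion c g ->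
  quasi_hyperbolicity_set B `<=` quasi_hyperbolicity_set A.
Proof.
move=> c0 gc mu [mu0 [delta [delta0 B4]]]; split=> //.
exists (delta + c + mu * c); split; first by rewrite !addr_ge0 ?mulr_ge0.
exact: four_point_inequality_pullback gc B4.
Qed.

(** The quasi-inverse sends [y] to a chosen point whose image is [r]-close to
    [y]: replacing [y] and [y'] by these images costs [2 * r], and [f] itself
    costs [k]. *)
Lemma rough_isometry_quasi_inverse {R : realType} {X Y : metricType R}
    (f : X -> Y) (k r : R) :
  additive_distortion k f ->
  (forall y : Y, exists x : X, mdist (f x) y < r) ->
  exists g : Y -> X, additive_distortion (k + 2 * r) g.
Proof.
move=> fk /choice[g gr]; exists g => u v.
have := fk (g u) (g v); rewrite ler_norml => /andP[fk1 fk2].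
have hu := gr u; have hv := gr v.
have t1 := metric_triangle u (f (g u)) v.
have t2 := metric_triangle (f (g u)) (f (g v)) v.
have t3 := metric_triangle (f (g u)) u (f (g v)).
have t4 := metric_triangle u v (f (g v)).
rewrite (metric_sym u (f (g u))) in t1.
rewrite (metric_sym v (f (g v))) in t4.
by rewrite ler_norml; apply/andP; split; lra.
Qed.

Theorem corollary2p15 (R : realType) (X Y : metricType R) :
  roughly_isometric X Y ->
  quasi_hyperbolicity_constant X = quasi_hyperbolicity_constant Y.
Proof.
move=> [f [[k [k0 fk]] [r [r0 fr]]]].
have [g gc] := rough_isometry_quasi_inverse f k r fk fr.
congr inf; apply/seteqP; split.
  by apply: (quasi_hyperbolicity_set_pullback g (k + 2 * r)) => //; lra.
exact: (quasi_hyperbolicity_set_pullback f k).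
Qed.
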